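(* Let $\mathcal{S}$ be a nonempty finite set, $k\ge1$ an integer, $\mathcal{U}=\{1,\ldots,k\}$, and $p:\mathcal{S}\to[0,1]$ a probability mass function. For each $i\in\mathcal{U}$ let $d_i$ be a metric on $\mathcal{S}$ and let $c_i:\mathcal{S}\to[0,\infty)$ be a function. Consider the stochastic $k$-server problem with server-dependent processing costs, with state space $\mathcal{X}=\mathcal{S}^{k+1}$ and one-period cost $$r(x,u)=d_u(x_u,\widehat{x})+c_u(\widehat{x})\qquad\text{for } x=(\widehat{x},x_1,\ldots,x_k)\in\mathcal{X},\ u\in\mathcal{U}.$$ Let $\mu_*$ be an optimal static state-feedback policy. Then there exists a decentralized policy $\mu_d$ such that $$J(\mu_d,x(0))\le 2\,J(\mu_*,x(0))\qquad\text{for all }x(0)\in\mathcal{X}.$$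
   Context: Dynamics: at each time $t\in\{0,1,2,\ldots\}$ the state is $x(t)=(\widehat{x}(t),x_1(t),\ldots,x_k(t))\in\mathcal{X}=\mathcal{S}^{k+1}$, where $\widehat{x}(t)$ is the location of the current service request and $x_i(t)$ is the location of server $i$. An action $u(t)\in\mathcal{U}$ (the index of the server dispatched) is chosen and the cost $r(x(t),u(t))$ is incurred. Then $x_{u(t)}(t+1)=\widehat{x}(t)$, $x_i(t+1)=x_i(t)$ for $i\ne u(t)$, and the next request $\widehat{x}(t+1)$ is drawn from $p$, independently of everything up to time $t$. A static state-feedback policy is a function $\mu:\mathcal{X}\to\mathcal{U}$; under it $u(t)=\mu(x(t))$, so the state evolves as a finite Markov chain $X(t)$. Its average per-period cost from initial state $x(0)$ is $$J(\mu,x(0))=\lim_{t\to\infty}\frac{1}{t+1}\sum_{\tau=0}^{t}E\big[r(X(\tau),\mu(X(\tau)))\,\big|\,X(0)=x(0)\big].$$ An optimal policy $\mu_*$ is a static state-feedback policy which minimizes $J(\mu,x(0))$ over all static state-feedback policies $\mu$, for every $x(0)\in\mathcal{X}$. A decentralized policy is a static state-feedback policy $\mu_d$ for which there is a partition of $\mathcal{S}$ into disjoint (possibly empty) sets $\mathcal{S}_1,\ldots,\mathcal{S}_k$ with $\mu_d(\widehat{x},x_1,\ldots,x_k)=i$ if and only if $\widehat{x}\in\mathcal{S}_i$. *)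

(* Defs.v *)
(* MathComp / MathComp-Analysis *)
From HB Require Import structures.
From mathcomp Require Import all_boot all_order all_algebra.
From mathcomp Require Import all_classical all_reals all_analysis.
Set Implicit Arguments.
Unset Strict Implicit.
Unset Printing Implicit Defensive.
Import Order.TTheory GRing.Theory Num.Theory.
Import numFieldNormedType.Exports.
Local Open Scope ring_scope.

(* The library's metricType bundles a single distance with the carrier, whereas
   here the same set carries one metric per server. *)
Definition is_metric (R : realType) (S : finType) (d : S -> S -> R) : Prop :=
  [/\ forall x y, 0 <= d x y,
      forall x y, d x y = 0 <-> x = y,
      forall x y, d x y = d y x &
      forall x y z, d x z <= d x y + d y z].

Definition is_pmf (R : realType) (S : finType) (p : S -> R) : Prop :=
  (forall s, 0 <= p s <= 1) /\ \sum_(s : S) p s = 1.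

(* Servers are numbered 0, ..., k-1. *)
Definition state (S : finType) (k : nat) : Type := (S * {ffun 'I_k -> S})%type.

Definition request (S : finType) (k : nat) (x : state S k) : S := x.1.

Definition location (S : finType) (k : nat) (x : state S k) (i : 'I_k) : S :=
  x.2 i.

Definition policy (S : finType) (k : nat) : Type := state S k -> 'I_k.

Definition next_state (S : finType) (k : nat)
    (x : state S k) (u : 'I_k) (z : S) : state S k :=
  (z, [ffun i => if i == u then request x else location x i]).

(* State reached from x0 under mu when the successive new requests
   (those of times 1, 2, ...) are listed by w. *)
Definition trajectory (S : finType) (k : nat) (mu : policy S k)
    (x0 : state S k) (w : seq S) : state S k :=
  foldl (fun x z => next_state x (mu x) z) x0 w.

Definition stage_cost (R : realType) (S : finType) (k : nat)
    (d : 'I_k -> S -> S -> R) (c : 'I_k -> S -> R)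
    (x : state S k) (u : 'I_k) : R :=
  d u (location x u) (request x) + c u (request x).

(* E[f(X(t)) | X(0) = x0]: X(t) is determined by x0 and by the t requests of
   times 1, ..., t, which are i.i.d. with law p. *)
Definition expectation_at (R : realType) (S : finType) (k : nat) (p : S -> R)
    (mu : policy S k) (x0 : state S k) (t : nat) (f : state S k -> R) : R :=
  \sum_(w : t.-tuple S)
    (\prod_(j < t) p (tnth w j)) * f (trajectory mu x0 w).

(* For a finite chain these Cesaro means always converge, so the total
   operator lim returns the actual limit. *)
Definition average_cost (R : realType) (S : finType) (k : nat) (p : S -> R)
    (d : 'I_k -> S -> S -> R) (c : 'I_k -> S -> R)
    (mu : policy S k) (x0 : state S k) : R :=
  lim ((fun t : nat =>
    t.+1%:R^-1 * \sum_(0 <= tau < t.+1)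
      expectation_at p mu x0 tau (fun x => stage_cost d c x (mu x))) @ \oo)%classic.

Definition is_optimal (R : realType) (S : finType) (k : nat) (p : S -> R)
    (d : 'I_k -> S -> S -> R) (c : 'I_k -> S -> R) (mu : policy S k) : Prop :=
  forall (mu' : policy S k) (x0 : state S k),
    average_cost p d c mu x0 <= average_cost p d c mu' x0.

Definition is_decentralized (S : finType) (k : nat) (mu : policy S k) : Prop :=
  exists part : 'I_k -> {set S},
    [/\ forall i j, i != j -> [disjoint part i & part j],
        (\bigcup_(i : 'I_k) part i)%SET = [set: S]%SET &
        forall (x : state S k) (i : 'I_k),
          mu x = i <-> request x \in part i].

(* Main.v *)
(** Let [a] be a placement of the servers minimising
   M = sum_s p(s) min_i (d_i(a_i, s) + c_i(s)), and let [mu_d] send each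
   request to the server attaining the minimum at [a].  Requests are
   independent of the current placement, so from time 1 on every policy pays
   at least M per period on average.  Under [mu_d], the potential
   h(x) = sum_i d_i(x_i, a_i) changes by d_u(s, a_u) - d_u(x_u, a_u) when server
   u serves s, so the triangle inequality through a_u bounds the cost by
   2 d_u(a_u, s) + c_u(s) plus a telescoping term, hence by 2 M on average.
   Existence of the limits is the mean ergodic theorem in finite dimension. *)
Require Import Defs.
From HB Require Import structures.
From mathcomp Require Import all_boot all_order all_algebra.
From mathcomp Require Import all_classical all_reals all_analysis.
From mathcomp Require Import lra.
Import Order.TTheory GRing.Theory Num.Theory.
Import numFieldNormedType.Exports.
Local Open Scope ring_scope.

(** * Cesàro means and the mean ergodic theorem in finite dimension *)

Lemma cvgn_inv_mul_bounded (R : realType) (u : nat -> R) (B : R) :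
  (forall n, `|u n| <= B) ->
  ((fun n => n.+1%:R^-1 * u n) @ \oo --> (0 : R))%classic.
Proof.
move=> uB.
have hB : ((fun n : nat => n.+1%:R^-1 * B) @ \oo --> (0 : R))%classic.
  rewrite -[X in (_ --> X)%classic](mul0r B).
  by apply: cvgM; [exact: cvg_harmonic | exact: cvg_cst].
apply/norm_cvg0P; apply: (squeeze_cvgr _ (cvg_cst 0) hB).
near=> n; rewrite normr_ge0 /= normrM ger0_norm ?invr_ge0//.
by rewrite ler_wpM2l ?invr_ge0.
Unshelve. all: by end_near.
Qed.

Section MeanErgodic.
Variables (R : realType) (X : finType) (T : 'End({ffun X -> R^o})).

Definition iter_mean (f : {ffun X -> R^o}) (x : X) : nat -> R :=
  arithmetic_mean (fun t => iter t T f x : R).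

Lemma iter_linD t (f g : {ffun X -> R^o}) :
  iter t T (f + g) = iter t T f + iter t T g.
Proof. by elim: t => //= t ->; rewrite linearD. Qed.

Lemma iter_linN t (f : {ffun X -> R^o}) : iter t T (- f) = - iter t T f.
Proof. by elim: t => //= t ->; rewrite linearN. Qed.

(** Nonexpansiveness for the sup norm, phrased through explicit bounds; it keeps all iterates of a
    function uniformly bounded. *)
Hypothesis T_contr : forall (B : R) (f : {ffun X -> R^o}),
  (forall x, `|f x : R| <= B) -> forall x, `|T f x : R| <= B.

Lemma iter_mean_fixed (f : {ffun X -> R^o}) x :
  T f = f -> (iter_mean f x @ \oo --> (f x : R))%classic.
Proof.
move=> Tf; rewrite (_ : iter_mean f x = fun=> f x); first exact: cvg_cst.
apply/funext => n; rewrite /iter_mean /arithmetic_mean /series/=.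
rewrite (eq_bigr (fun=> f x : R)); last by move=> t _; rewrite iter_fix.
rewrite sumr_const_nat subn0 -[X in _ * X]mulr_natl.
by apply: mulKf; rewrite pnatr_eq0.
Qed.

(** The sum telescopes to [g - iter n.+1 T g], which stays bounded while it is divided by [n.+1]. *)
Lemma iter_mean_coboundary (g : {ffun X -> R^o}) x :
  (iter_mean (g - T g) x @ \oo --> (0 : R))%classic.
Proof.
pose B : R := \sum_y `|g y : R|.
have gB y : `|g y : R| <= B.
  by rewrite /B (bigD1 y)//= lerDl sumr_ge0.
have iB t y : `|(iter t T g) y : R| <= B.
  by elim: t y => //= t ih; exact: T_contr.
apply: (@cvgn_inv_mul_bounded R
  (fun n => \sum_(0 <= t < n.+1) (iter t T (g - T g)) x) (B + B)) => n.
rewrite (eq_bigr (fun t => - ((iter t.+1 T g x : R) - iter t T g x))); last first.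
  move=> t _; rewrite iter_linD ffunE iterSr opprB; congr (_ + _).
  by rewrite iter_linN ffunE.
by rewrite sumrN telescope_sumr// normrN (le_trans (ler_normB _ _))// lerD.
Qed.

(* A power-bounded operator T has ker (1 - T) and im (1 - T) in direct sum, as
   the averages are constant on the former and vanish in the limit on the
   latter; by rank-nullity they span. *)
Lemma mean_ergodic (f : {ffun X -> R^o}) x : cvgn (iter_mean f x).
Proof.
pose D := (\1%VF - T)%R : 'End({ffun X -> R^o}).
have DE g : D g = g - T g by rewrite /D add_lfunE opp_lfunE id_lfunE.
have disj : (lker D :&: limg D = 0)%VS.
  apply/eqP; rewrite -subv0; apply/subvP => h.
  rewrite memv_cap memv_ker DE subr_eq0 => /andP[/eqP hfix /memv_imgP[g _ hg]].
  rewrite memv0; apply/eqP/ffunP => y; rewrite ffunE.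
  apply: (@cvg_unique _ _ (iter_mean h y @ \oo)%classic).
  - exact: norm_hausdorff.
  - exact: (iter_mean_fixed _ _ (esym hfix)).
  - by rewrite hg DE; exact: iter_mean_coboundary.
have full : (lker D + limg D = fullv)%VS.
  apply/eqP; rewrite eqEdim subvf/= dimv_disjoint_sum//.
  by rewrite -(limg_ker_dim D fullv) capfv.
have : f \in (lker D + limg D)%VS by rewrite full memvf.
move=> /memv_addP[h hker [_ /memv_imgP[g _ ->] ->]].
move: hker; rewrite memv_ker DE subr_eq0 => /eqP/esym hfix.
have -> : iter_mean (h + D g) x = iter_mean h x \+ iter_mean (D g) x.
  apply/funext => n; rewrite /iter_mean /arithmetic_mean /series/=.
  rewrite -mulrDr -big_split/=.
  by congr (_ * _); apply: eq_bigr => t _; rewrite iter_linD ffunE.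
apply: is_cvgD; first by apply/cvg_ex; exists (h x); exact: iter_mean_fixed.
by apply/cvg_ex; exists 0; rewrite DE; exact: iter_mean_coboundary.
Qed.

End MeanErgodic.

(** * The Markov chain of a fixed policy and bounds on its average cost *)

Section Chain.
Variables (R : realType) (S : finType) (k : nat) (p : S -> R).
Hypothesis hp : is_pmf p.
Variable mu : policy S k.

(** The Markov operator of the chain under [mu], acting on functions of the state. *)
Definition transition (f : state S k -> R) (x : state S k) : R :=
  \sum_z p z * f (next_state x (mu x) z).

Lemma expectation_at0 x f : expectation_at p mu x 0 f = f x.
Proof.
rewrite /expectation_at (big_pred1 [tuple])/=; last first.
  by move=> w; apply/esym/eqP; exact: tuple0.
by rewrite big_ord0 mul1r.
Qed.

(** Condition on the first request: a tuple of [t.+1] requests is a head and a tail, and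
    [trajectory], being a left fold, runs over the tail from the state that the head produces. *)
Lemma expectation_atS x t f : expectation_at p mu x t.+1 f =
  transition (fun y => expectation_at p mu y t f) x.
Proof.
rewrite /transition /expectation_at.
under [RHS]eq_bigr do rewrite big_distrr/=.
rewrite pair_bigA/=.
rewrite (reindex (fun zw : S * t.-tuple S => [tuple of zw.1 :: zw.2]))/=; last first.
  exists (fun w : t.+1.-tuple S => (thead w, [tuple of behead w])).
    by case=> z w _; rewrite theadE; congr pair; exact: val_inj.
  by move=> w _; rewrite [RHS]tuple_eta.
apply: eq_bigr => -[z w] _ /=.
rewrite big_ord_recl/= tnth0 mulrA; congr (_ * _ * _).
by apply: eq_bigr => j _; rewrite tnthS.
Qed.

Lemma expectation_at_iter t f x :
  expectation_at p mu x t f = iter t transition f x.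
Proof.
elim: t x => [|t ih] x; first exact: expectation_at0.
by rewrite expectation_atS/= /transition; apply: eq_bigr => z _; rewrite ih.
Qed.

Lemma transition_le f g x :
  (forall y, f y <= g y) -> transition f x <= transition g x.
Proof.
by move=> fg; apply: ler_sum => z _; rewrite ler_wpM2l//; case/andP: (hp.1 z).
Qed.

Lemma transition_cst a x : transition (fun=> a) x = a.
Proof. by rewrite /transition -big_distrl/= hp.2 mul1r. Qed.

Lemma transition_norm_le f (B : R) :
  (forall y, `|f y| <= B) -> forall x, `|transition f x| <= B.
Proof.
move=> fB x; rewrite -[leRHS](transition_cst B x).
rewrite (le_trans (ler_norm_sum _ _ _))//; apply: ler_sum => z _.
have p0 : 0 <= p z by case/andP: (hp.1 z).
by rewrite normrM ger0_norm// ler_wpM2l.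
Qed.

Lemma iter_transitionD t f g x : iter t transition (fun y => f y + g y) x =
  iter t transition f x + iter t transition g x.
Proof.
elim: t x => //= t ih x; rewrite /transition -big_split/=.
by apply: eq_bigr => z _; rewrite ih mulrDr.
Qed.

Lemma iter_transition_cst t a x : iter t transition (fun=> a) x = a.
Proof.
elim: t x => //= t ih x.
by rewrite -[RHS](transition_cst a x); apply: eq_bigr => z _; rewrite ih.
Qed.

Lemma iter_transition_le t f g x :
  (forall y, f y <= g y) -> iter t transition f x <= iter t transition g x.
Proof. by move=> fg; elim: t x => //= t ih x; exact: transition_le. Qed.

Lemma iter_transition_norm_le t f (B : R) :
  (forall y, `|f y| <= B) -> forall x, `|iter t transition f x| <= B.
Proof. by move=> fB; elim: t => //= t ih; exact: transition_norm_le. Qed.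

Definition cesaro_cost (r : state S k -> R) (x : state S k) : nat -> R :=
  arithmetic_mean (fun t => expectation_at p mu x t r).

(** Averaging against [p] is linear and nonexpansive, so [transition] can be packaged as an
    endomorphism of a finite-dimensional space to which [mean_ergodic] applies. *)
Lemma cesaro_cost_cvg r x : cvgn (cesaro_cost r x).
Proof.
pose X : finType := (S * {ffun 'I_k -> S})%type.
pose T0 (f : {ffun X -> R^o}) : {ffun X -> R^o} := [ffun y => transition f y].
have T0lin : linear T0.
  move=> a f g; apply/ffunP => y; rewrite !ffunE /transition.
  rewrite scaler_sumr -big_split/=; apply: eq_bigr => z _.
  by rewrite !ffunE mulrDr; congr (_ + _); rewrite mulrCA.
pose T0L := GRing.isLinear.Build R {ffun X -> R^o} {ffun X -> R^o} *:%R T0 T0lin.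
pose T0l : {linear {ffun X -> R^o} -> {ffun X -> R^o}} := HB.pack T0 T0L.
pose T := linfun T0l.
have TE g y : T g y = transition g y by rewrite lfunE/= ffunE.
have Tc (B : R) (f : {ffun X -> R^o}) :
    (forall y, `|f y : R| <= B) -> forall y, `|T f y : R| <= B.
  by move=> fB y; rewrite TE; exact: transition_norm_le.
suff -> : cesaro_cost r x = iter_mean _ _ T [ffun y => r y] x.
  exact: mean_ergodic.
congr arithmetic_mean; apply/funext => t.
rewrite expectation_at_iter; elim: t x => [|t ih] x; first by rewrite ffunE.
by rewrite !iterS TE; apply: eq_bigr => z _; rewrite ih.
Qed.

Let cesaro_bound (m B : R) :
  ((fun n : nat => m + n.+1%:R^-1 * B) @ \oo --> m)%classic.
Proof.
rewrite -[X in (_ --> X)%classic]addr0; apply: cvgD; first exact: cvg_cst.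
exact: (@cvgn_inv_mul_bounded R (fun=> B) `|B|).
Qed.

(** The bound is asked of the expected cost one step ahead because the initial request is arbitrary;
    only later ones follow [p]. The period 0 is lost in the limit. *)
Lemma cesaro_cost_lim_ge r x (m : R) :
  (forall y, m <= transition r y) -> m <= limn (cesaro_cost r x).
Proof.
(* [r x - m] corrects for period 0, the one period whose cost may be below [m]. *)
move=> rm; have cb := cesaro_bound m (r x - m).
rewrite -[leLHS](cvg_lim _ cb); last exact: norm_hausdorff.
apply: ler_lim; [by apply/cvg_ex; exists m | exact: cesaro_cost_cvg |].
apply: nearW => n; rewrite /cesaro_cost /arithmetic_mean /series/=.
rewrite -[X in X + _](mulKf (_ : n.+1%:R != 0)) ?pnatr_eq0// -mulrDr.
rewrite ler_wpM2l ?invr_ge0// big_nat_recl// expectation_at0.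
have : \sum_(0 <= t < n) m <= \sum_(0 <= t < n) expectation_at p mu x t.+1 r.
  apply: ler_sum => t _; rewrite expectation_at_iter iterSr.
  by rewrite -[leLHS](iter_transition_cst t m x); exact: iter_transition_le.
rewrite sumr_const_nat subn0 -[(m *+ n)]mulr_natl => h.
rewrite -(natr1 n); lra.
Qed.

(** A drift inequality with potential [h]: summed over time, the changes of [h] telescope to a
    bounded quantity, so [r] costs on average no more than [g]. *)
Lemma cesaro_cost_lim_le r g h x (m : R) :
  (forall y, r y + transition h y <= g y + h y) ->
  (forall y, transition g y <= m) ->
  limn (cesaro_cost r x) <= m.
Proof.
move=> rgh gm.
pose H : R := \sum_(y : S * {ffun 'I_k -> S}) `|h y|.
have hH y : `|h y| <= H by rewrite /H (bigD1 y)//= lerDl sumr_ge0.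
(* [g x - m] corrects for period 0; [h x + H] bounds the telescoped potential, its initial value
   minus its final expectation. *)
have cb := cesaro_bound m (g x - m + h x + H).
rewrite -[leRHS](cvg_lim _ cb); last exact: norm_hausdorff.
apply: ler_lim; [exact: cesaro_cost_cvg | by apply/cvg_ex; exists m |].
apply: nearW => n; rewrite /cesaro_cost /arithmetic_mean /series/=.
rewrite -[X in _ <= X + _](mulKf (_ : n.+1%:R != 0)) ?pnatr_eq0// -mulrDr.
rewrite ler_wpM2l ?invr_ge0//.
pose E f t := iter t transition f x.
have step t : expectation_at p mu x t r <= E g t - (E h t.+1 - E h t).
  rewrite expectation_at_iter.
  have := iter_transition_le t _ _ x rgh.
  rewrite !iter_transitionD -iterSr /E; lra.
have := @ler_sum_nat _ 0 n.+1 _ _ (fun t _ => step t).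
move/le_trans; apply; rewrite big_split/= sumrN telescope_sumr//.
rewrite big_nat_recl// {1}/E /=.
have : \sum_(0 <= t < n) E g t.+1 <= \sum_(0 <= t < n) m.
  apply: ler_sum => t _; rewrite /E iterSr.
  by rewrite -[leRHS](iter_transition_cst t m x); exact: iter_transition_le.
rewrite sumr_const_nat subn0 -[(m *+ n)]mulr_natl => hg.
have := iter_transition_norm_le n.+1 _ _ hH x.
rewrite ler_norml -/(E h n.+1) => /andP[hn _].
rewrite -(natr1 n) (_ : E h 0 = h x)//; lra.
Qed.

End Chain.

(** * Comparison of fixed home locations with the optimum *)

Theorem theorem4 (R : realType) (S : finType) (k : nat)
    (hS : (0 < #|S|)%N) (hk : (1 <= k)%N)
    (p : S -> R) (hp : is_pmf p)
    (d : 'I_k -> S -> S -> R) (hd : forall i : 'I_k, is_metric (d i))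
    (c : 'I_k -> S -> R) (hc : forall (i : 'I_k) (s : S), 0 <= c i s)
    (mu_star : policy S k) (hmu : is_optimal p d c mu_star) :
  exists mu_d : policy S k,
    is_decentralized mu_d /\
    forall x0 : state S k,
      average_cost p d c mu_d x0 <= 2 * average_cost p d c mu_star x0.
Proof.
have /card_gt0P[s0 _] := hS.
pose i0 : 'I_k := Ordinal hk.
pose cost (y : {ffun 'I_k -> S}) s i := d i (y i) s + c i s.
pose near y s : 'I_k := [arg min_(i < i0) cost y s i]%O.
have nearP y s i : cost y s (near y s) <= cost y s i.
  by rewrite /near; case: Order.TotalTheory.arg_minP => // j _; apply.
pose M y : R := \sum_s p s * cost y s (near y s).
pose a := [arg min_(y < [ffun=> s0]) M y]%O.
have aP y : M a <= M y.
  by rewrite /a; case: Order.TotalTheory.arg_minP => // j _; apply.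
have p_ge0 s : 0 <= p s by case/andP: (hp.1 s).
have lower x0 : M a <= average_cost p d c mu_star x0.
  apply: (@cesaro_cost_lim_ge R S k p hp) => x.
  (* The placement after the move does not depend on the new request, so [s0] is a dummy argument
     here. *)
  apply: le_trans (aP (next_state x (mu_star x) s0).2) _.
  by apply: ler_sum => z _; rewrite ler_wpM2l//; exact: nearP.
exists (fun x => near a (request x)); split.
  exists (fun i => [set s | near a s == i]%SET); split.
  - move=> i j ij; apply/pred0P => s /=; rewrite !inE.
    by case: eqP => // ->; exact: negbTE.
  - apply/setP => s; rewrite inE; apply/bigcupP; exists (near a s) => //.
    by rewrite inE.
  - by move=> x i; rewrite inE; split=> /eqP.
move=> x0; apply: le_trans (ler_wpM2l _ (lower x0)) => //.
pose h (x : state S k) : R := \sum_i d i (location x i) (a i).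
pose g (x : state S k) : R := 2 * cost a (request x) (near a (request x)).
apply: (@cesaro_cost_lim_le R S k p hp _ _ g h) => x; last first.
  by rewrite /M mulr_sumr; apply: ler_sum => z _; rewrite mulrCA.
set u := near a (request x).
have [_ _ dC dT] := hd u.
(* [h] ignores the request, so its next value is deterministic: only the term of [u] changes, as
   that server moves to the request. The right side is rewritten as the transition of a constant to
   compare summands. *)
have hnext : transition R S k p (fun x => near a (request x)) h x =
    h x - d u (location x u) (a u) + d u (request x) (a u).
  rewrite -[RHS](transition_cst R S k p hp (fun x => near a (request x)) _ x).
  apply: eq_bigr => z _; congr (_ * _); rewrite /h (bigD1 u)//= [in RHS](bigD1 u)//=.
  rewrite {1}/location ffunE eqxx (addrC (d u (location x u) _)) addrK addrC.
  congr (_ + _).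
  by apply: eq_bigr => i /negbTE iu; rewrite /location ffunE iu.
rewrite hnext /stage_cost /g /cost -/u.
(* The triangle inequality through [a u] gives twice the distance plus one processing cost;
   nonnegativity of [c] raises this to twice the full cost in [g]. *)
have := dT (location x u) (a u) (request x).
have := hc u (request x).
rewrite (dC (request x) (a u)); lra.
Qed.
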